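(* Let $F([x;r])=\kappa r+f(x)$ and consider the composite optimization problem $$F_*=\mathrm{Opt}=\min_{x,r}\{F([x;r]):\ x\in K,\ \|x\|\le r\},$$ under the assumption that there exists $D<\infty$ such that the relations $\kappa r+f(x)\le f(0)$, $\|x\|\le r$, $x\in K$ imply $r\le D$; let $D_*$ be the smallest such $D$, and let $D^+<\infty$ be an upper bound on $D_*$. A generic Conditional Gradient algorithm for composite optimization, that is, a recurrence building points $z_t$, $t=1,2,\dots$, with $$z_1=0;\qquad F(z_{t+1})\le\min_z\{F(z):\ z\in\mathrm{Conv}(\Delta(z_t)\cup\{z_t\})\},\quad t=1,2,\dots$$ (as specified in the context), maintains the inclusions $z_t\in K^+$ and is a descent algorithm: $F(z_{t+1})\le F(z_t)$ for all $t$. Besides this, $$F(z_t)-F_*\le\frac{8L_fD_*^2}{t+14},\qquad t=2,3,\dots$$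
   Context: $E$ is a Euclidean space with inner product $\langle\cdot,\cdot\rangle$, $K\subset E$ is a closed convex cone which linearly spans $E$, $\|\cdot\|$ is a norm on $E$ (not necessarily Euclidean) with dual norm $\|\cdot\|_*$, $\kappa>0$, and $f:K\to\mathbb R$ is a convex function with Lipschitz continuous gradient: $\|f'(x)-f'(y)\|_*\le L_f\|x-y\|$ for all $x,y\in K$, whence $f(y)\le f(x)+\langle f'(x),y-x\rangle+\frac{L_f}{2}\|y-x\|^2$ for all $x,y\in K$. For $\eta\in E$, $x[\eta]$ denotes the minimizer of $\langle\eta,x\rangle$ over $\{x\in K:\|x\|\le1\}$ returned by a fixed Linear Optimization oracle; it is assumed that for every $\eta$ either $x[\eta]=0$ or $\|x[\eta]\|=1$ (namely, $x[\eta]=0$ whenever $\langle\eta,x[\eta]\rangle=0$). $E^+=E\times\mathbb R$, with elements written $[x;r]$, and $K^+=\{[x;r]:x\in K,\ \|x\|\le r\}$. For $z=[x;r]\in K^+$, $\Delta(z)=\{\rho\,[x[f'(x)];1]:\ 0\le\rho\le D^+\}$, a segment in $E^+$. $\mathrm{Conv}$ is the convex hull. In the generic algorithm, $z_{t+1}$ may be any point of $K^+$ satisfying the displayed inequality (e.g., a minimizer of $F$ over $\mathrm{Conv}(\Delta(z_t)\cup\{z_t\})$). *)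

(* Defs.v *)
From HB Require Import structures.
From mathcomp Require Import all_boot all_order all_algebra.
From mathcomp Require Import all_classical all_reals all_analysis.

Set Implicit Arguments.
Unset Strict Implicit.
Unset Printing Implicit Defensive.

Import Order.TTheory GRing.Theory Num.Theory.
Import numFieldNormedType.Exports.

Local Open Scope classical_set_scope.
Local Open Scope ring_scope.

(** A Euclidean space carrying a second, arbitrary norm is a space [E] of the
    following type, whose norm [`|x|] (and topology) is the arbitrary norm,
    together with a separate inner product [dot : {dot E for idfun}]. *)
#[short(type="finNormedModType")]
HB.structure Definition FinNormedModule (R : numFieldType) :=
  {E of NormedModule R E & Vector R E}.

Section ConvexGeometry.
Context {R : realType}.

Definition convex_cone (E : lmodType R) (K : set E) :=
  [/\ K !=set0, convex_set K &
      forall (a : R) x, 0 <= a -> K x -> K (a *: x)].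

Definition spanning (E : vectType R) (K : set E) :=
  forall U : {vspace E}, (forall x, K x -> x \in U) -> U = fullv.

Definition conv_hull (E : lmodType R) (A : set E) : set E :=
  smallest (@convex_set R E) A.

(** An infimum, hence a meaningful value when [A] is nonempty and [F] is
    bounded below on [A]; this is so in both uses below, under the standing
    assumptions, and there the infimum is attained. *)
Definition opt_val (T : Type) (F : T -> R) (A : set T) : R := inf (F @` A).

End ConvexGeometry.

Section SmoothFunctions.
Context {R : realType} {E : finNormedModType R}.
Variable dot : {dot E for idfun}.
Implicit Types (K : set E) (f : E -> R) (gradf : E -> E).

Definition dual_norm (eta : E) : R :=
  sup [set dot eta x | x in [set x : E | `|x| <= 1]].

(** Differentiability relative to [K], so that it makes sense up to the
    boundary of [K]; the gradient is unique when [K] is a spanning convex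
    cone. *)
Definition gradient_on K f gradf := forall x, K x ->
  forall eps : R, 0 < eps -> \forall y \near within K (nbhs x),
    `|f y - f x - dot (gradf x) (y - x)| <= eps * `|y - x|.

Definition lipschitz_gradient_on K gradf (Lf : R) := forall x y, K x -> K y ->
  dual_norm (gradf x - gradf y) <= Lf * `|x - y|.

Definition lo_oracle K (lo : E -> E) := forall eta,
  [/\ K (lo eta), `|lo eta| <= 1,
      forall x, K x -> `|x| <= 1 -> dot eta (lo eta) <= dot eta x,
      lo eta = 0 \/ `|lo eta| = 1 &
      dot eta (lo eta) = 0 -> lo eta = 0].

End SmoothFunctions.

Section CompositeOptimization.
Context {R : realType} {E : finNormedModType R}.
Variables (K : set E) (kappa : R) (f : E -> R) (gradf : E -> E).
Variables (lo : E -> E) (Dplus : R).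

(** [kappa] weighs the norm in the objective; [lo] is the linear optimization
    oracle and [Dplus] the known upper bound on [Dstar].
    [R^o] is [R] seen as a module over itself, so that [E * R^o] is an
    [lmodType R]. *)
Definition Kplus : set (E * R^o) := [set z | K z.1 /\ `|z.1| <= z.2].

Definition Fobj (z : E * R^o) : R := kappa * z.2 + f z.1.

Definition Fstar : R := opt_val Fobj Kplus.

Definition level_bound (D : R) :=
  forall z, Kplus z -> Fobj z <= f 0 -> z.2 <= D.

(** The least [D] such that [level_bound D]; that set is closed and bounded
    below, so its infimum is attained as soon as it is nonempty. *)
Definition Dstar : R := inf level_bound.

Definition Delta (z : E * R^o) : set (E * R^o) :=
  [set rho *: ((lo (gradf z.1), 1) : E * R^o) |
    rho in [set rho : R | 0 <= rho <= Dplus]].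

(** Iterates are numbered from 1; the value [z 0%N] is irrelevant. *)
Definition generic_cndg (z : nat -> E * R^o) :=
  z 1%N = 0 /\
  forall t, (1 <= t)%N -> Kplus (z t.+1) /\
    Fobj (z t.+1) <= opt_val Fobj (conv_hull (Delta (z t) `|` [set z t])).

End CompositeOptimization.

(* Main.v *)
From HB Require Import structures.
Require Import Defs.
From mathcomp Require Import all_boot all_order all_algebra.
From mathcomp Require Import all_classical all_reals all_analysis.
From mathcomp Require Import lra ring.

(** Let [z] be an iterate, [z'] the next one and [g] the gradient of [f] at
    [z.1]; let [u] be a competitor in the lifted cone with [F u <= f 0], and
    put [v = u.2 *: (lo g, 1)].
    The point [v] lies on the segment [Delta z], because
    [u.2 <= Dstar <= Dplus], and it is at least as good as [u] for the
    linearization of [F] at [z]: rescaling [u.1] to the unit ball shows that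
    the oracle's answer satisfies [u.2 * dot g (lo g) <= dot g u.1].
    By convexity the linearization minorizes [F], so moving from [z] towards
    [v] has slope at most [F u - F z] ([linearized_gap]).  The descent
    inequality for smooth functions ([smooth_descent]) then bounds what is
    lost to curvature, and [z'], being no worse than any point of the segment
    from [z] to [v], satisfies ([cndg_step]), for all [0 <= s <= 1],

      [F z' - F u <= (1 - s) (F z - F u) + Lf / 2 * s^2 * (z.2 + u.2)^2].

    The first iterate is [0], so with [s = 1] the first step gives
    [F (z 2) - F u <= Lf * Dstar^2 / 2].  Afterwards both radii are at most
    [Dstar], the iterates staying in the level set of [0]; the resulting
    recursion [e' <= (1 - s) e + 2 Lf Dstar^2 s^2], used with
    [s = 2 / (t + 14)], reproduces the bound [8 Lf Dstar^2 / (t + 14)]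
    ([quadratic_recursion_rate]).  This holds for every competitor [u] with
    [F u <= f 0], the others being worse than every iterate, so the infimum
    over [u] gives the theorem.

    The dual norm is the supremum of a bounded set because linear maps on a
    finite dimensional space are bounded for whichever norm it carries
    ([findim_linear_bounded]).  The infimum that bounds the next iterate is
    below every value of [F] on the hull because [F] is bounded below on the
    cone ([Fobj_lower_bound]).  The case [Lf < 0] occurs only when [K] is
    trivial, and then [Dstar = 0] ([lipschitz_lt0_Dstar_eq0]). *)

Set Implicit Arguments.
Unset Strict Implicit.

Import Order.TTheory GRing.Theory Num.Theory.
Import numFieldNormedType.Exports VectorInternalTheory.

Local Open Scope classical_set_scope.
Local Open Scope ring_scope.

(** * Linear maps on finite dimensional normed spaces *)

Lemma rV_linear_bounded {R : realType} n (W : normedModType R)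
    (g : {linear 'rV[R]_n -> W}) :
  exists2 M, 0 <= M & forall v, `|g v| <= M * `|v|.
Proof.
exists (\sum_i `|g (delta_mx 0 i)|); first exact: sumr_ge0.
move=> v; rewrite {1}[v]row_sum_delta linear_sum mulr_suml.
apply: (le_trans (ler_norm_sum _ _ _)); apply: ler_sum => i _.
rewrite linearZ /= normrZ mulrC ler_wpM2l//.
rewrite [leRHS]/Num.norm /= mx_normrE.
by apply/bigmax_geP; right; exists (0, i).
Qed.

(** The constant is the minimum of [`|g v|] over the unit sphere of the
    maximum norm, which is compact. *)
Lemma rV_linear_coercive {R : realType} n (W : normedModType R)
    (g : {linear 'rV[R]_n -> W}) : injective g ->
  exists2 m, 0 < m & forall v, m * `|v| <= `|g v|.
Proof.
move=> g_inj; have [C C_ge0 leC] := rV_linear_bounded g.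
have g_cont : continuous g.
  apply: bounded_linear_continuous; apply/bounded_funP => r.
  by exists (C * r) => w wr; apply: le_trans (leC w) _; rewrite ler_wpM2l.
have normg_cont : continuous (fun v => `|g v|).
  have cont_norm (V : normedModType R) (h : V -> W) :
      continuous h -> continuous (fun v => `|h v|).
    by move=> h_cont v; apply: cvg_norm; exact: h_cont.
  exact: cont_norm g_cont.
set S := [set v : 'rV[R]_n | `|v| = 1].
have normalized v : v != 0 -> S (`|v|^-1 *: v).
  by move=> v0; rewrite /S/= normrZ normfV normr_id mulVf// normr_eq0.
(* The sphere is empty when [n = 0]. *)
have [S0|] := pselect (S !=set0); last first.
  move=> /set0P/negP/negPn/eqP S_eq0; exists 1 => // v.
  have [->|/normalized] := eqVneq v 0; first by rewrite normr0 mulr0.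
  by rewrite S_eq0.
have S_compact : compact S.
  apply: bounded_closed_compact.
    by exists 1; split=> // x x1 v /= ->; exact: ltW.
  have -> : S = (fun v : 'rV[R]_n => `|v|) @^-1` [set 1] by [].
  apply: closed_comp => [v _|]; first exact: norm_continuous.
  exact: closed_eq.
have [c] := compact_EVT_min S0 S_compact (continuous_subspaceT normg_cont).
rewrite inE => cS c_min; exists `|g c|.
  rewrite normr_gt0; apply/eqP => gc0.
  have c0 : c = 0 by apply: g_inj; rewrite gc0 linear0.
  by move: cS; rewrite /S/= c0 normr0 => /eqP; rewrite eq_sym oner_eq0.
move=> v; have [->|v0] := eqVneq v 0; first by rewrite normr0 mulr0.
have v_gt0 : 0 < `|v| by rewrite normr_gt0.
have /c_min : `|v|^-1 *: v \in S by rewrite inE; exact: normalized.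
by rewrite linearZ /= normrZ normfV normr_id ler_pdivlMl// mulrC.
Qed.

(** Coordinates are bounded in terms of the norm of [E], by coercivity of the
    coordinate isomorphism [r2v], and [g] is bounded in terms of them. *)
Lemma findim_linear_bounded {R : realType} (E : finNormedModType R)
    (W : normedModType R) (g : {linear E -> W}) :
  exists2 M, 0 <= M & forall x, `|g x| <= M * `|x|.
Proof.
have [m m_gt0 m_le] := rV_linear_coercive (@r2v_inj R E).
have [M M_ge0 leM] := rV_linear_bounded (g \o r2v).
exists (M / m); first by rewrite divr_ge0// ltW.
move=> x; rewrite -{1}(v2rK x); apply: le_trans (leM (v2r x)) _.
rewrite -mulrA ler_wpM2l// ler_pdivlMl//.
by apply: le_trans (m_le _) _; rewrite /= v2rK.
Qed.

(** * The dual norm *)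

Section DualNorm.
Context {R : realType} {E : finNormedModType R}.
Variable dot : {dot E for idfun}.

Lemma dotDr eta x y : dot eta (x + y) = dot eta x + dot eta y.
Proof. exact: linearDr. Qed.

Lemma dotZr eta a x : dot eta (a *: x) = a * dot eta x.
Proof. exact: linearZr_LR. Qed.

Lemma dotBr eta x y : dot eta (x - y) = dot eta x - dot eta y.
Proof. exact: linearBr. Qed.

Lemma dotBl x y h : dot (x - y) h = dot x h - dot y h.
Proof. exact: linearBl. Qed.

Lemma dot_bounded eta : exists2 M, 0 <= M & forall x, `|dot eta x| <= M * `|x|.
Proof.
have dot_linear : linear (dot eta : E -> R^o).
  by move=> a x y; rewrite dotDr dotZr.
pose d : {linear E -> R^o} := HB.pack (dot eta : E -> R^o)
  (GRing.isLinear.Build R E R^o _ (dot eta : E -> R^o) dot_linear).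
exact: (@findim_linear_bounded R E R^o d).
Qed.

Let ball_dot eta := [set dot eta x | x in [set x : E | `|x| <= 1]].

Let ball_dot_ubound eta : has_ubound (ball_dot eta).
Proof.
have [M M_ge0 leM] := dot_bounded eta.
exists M => _ [x /= x1 <-]; apply: le_trans (ler_norm _) _.
by apply: le_trans (leM x) _; rewrite ler_piMr.
Qed.

Lemma dual_norm_ge0 eta : 0 <= dual_norm dot eta.
Proof.
apply: (ub_le_sup (ball_dot_ubound eta)).
by exists 0; rewrite /= ?normr0// linear0r.
Qed.

Lemma le_dual_norm eta x : dot eta x <= dual_norm dot eta * `|x|.
Proof.
have [->|x0] := eqVneq x 0; first by rewrite linear0r normr0 mulr0.
have x_gt0 : 0 < `|x| by rewrite normr_gt0.
rewrite -ler_pdivrMr// mulrC -dotZr.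
apply: (ub_le_sup (ball_dot_ubound eta)); exists (`|x|^-1 *: x) => //=.
by rewrite normrZ normfV normr_id mulVf ?gt_eqF.
Qed.

End DualNorm.

(** * Smooth convex functions on a convex set *)

Lemma convex_set_segment {R : realType} (V : lmodType R) (A : set V) x y
    (s : R) : convex_set A -> A x -> A y -> 0 <= s <= 1 ->
  A (x + s *: (y - x)).
Proof.
move=> A_conv Ax Ay /andP[s0 s1].
have := A_conv y x (Itv01 s0 s1).
rewrite !inE => /(_ Ay Ax); congr (A _).
by rewrite /conv /= /unstable.onem scalerBl scale1r scalerBr addrCA.
Qed.

Section SmoothConvex.
Context {R : realType} {E : finNormedModType R}.
Variables (dot : {dot E for idfun}) (K : set E) (f : E -> R) (gradf : E -> E).
Hypotheses (K_conv : convex_set K) (f_conv : convex_function K f).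

Lemma convex_function_segment x y s : K x -> K y -> 0 <= s <= 1 ->
  f (x + s *: (y - x)) <= f x + s * (f y - f x).
Proof.
move=> Kx Ky /andP[s0 s1].
have := @f_conv (Itv01 s0 s1) y x; rewrite !inE => /(_ Ky Kx).
rewrite /conv /= /unstable.onem /conv /= /unstable.onem.
rewrite scalerBl scale1r addrCA -scalerBr => /le_trans; apply.
by rewrite -![_ *: (_ : R^o)]/(_ * _); lra.
Qed.

Hypothesis f_grad : gradient_on dot K f gradf.

(** Convexity bounds the difference quotients along the segment from [x] to
    [y] by [f y - f x], and differentiability at [x] makes them approach the
    left-hand side; only one sufficiently short step is needed for each
    tolerance [e]. *)
Lemma convex_gradient_le x y : K x -> K y ->
  dot (gradf x) (y - x) <= f y - f x.
Proof.
move=> Kx Ky; apply/ler_addgt0Pr => e e0.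
set h := y - x.
have h1 : 0 < `|h| + 1 by rewrite ltr_wpDl.
have e1 : 0 < e / (`|h| + 1) by rewrite divr_gt0.
have := f_grad Kx e1.
rewrite near_withinE => /nbhs_ballP[d /= d0 near_x].
pose s := Num.min 1 (d / (2 * (`|h| + 1))).
have s0 : 0 < s by rewrite lt_min ltr01 divr_gt0// mulr_gt0.
have s1 : s <= 1 by rewrite ge_min lexx.
have s01 : 0 <= s <= 1 by rewrite ltW.
have := near_x (x + s *: h); rewrite -ball_normE /= opprD addNKr normrN.
rewrite [x + _ - x]addrAC subrr add0r normrZ (gtr0_norm s0).
have sh : s * `|h| < d.
  have : s * (`|h| + 1) < d.
    have : s <= d / (2 * (`|h| + 1)) by rewrite ge_min lexx orbT.
    rewrite ler_pdivlMr ?mulr_gt0//; nra.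
  nra.
move=> /(_ sh (convex_set_segment K_conv Kx Ky s01)).
have := convex_function_segment Kx Ky s01; rewrite -/h => f_le.
rewrite dotZr ler_norml => /andP[f_ge _].
have eh : e / (`|h| + 1) * (s * `|h|) <= s * e.
  have {2}-> : e = e / (`|h| + 1) * (`|h| + 1) by rewrite divfK// gt_eqF.
  by rewrite mulrCA ler_wpM2l ?ler_wpM2l ?lerDl// ltW.
rewrite -(ler_pM2l s0); lra.
Qed.

Variable Lf : R.
Hypothesis f_lip : lipschitz_gradient_on dot K gradf Lf.

(** Instead of integrating the gradient along the segment, the proof cuts it
    into [n.+1] equal pieces. On each piece [convex_gradient_le], applied at
    the far endpoint, bounds the increase of [f] by a slope that differs from
    the one at [x] by the Lipschitz bound. The sum of these bounds is the
    right-hand side plus an error of order [1 / n.+1]. *)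
Lemma smooth_descent x y : K x -> K y ->
  f y <= f x + dot (gradf x) (y - x) + Lf / 2 * `|y - x| ^+ 2.
Proof.
move=> Kx Ky; set h := y - x.
pose w n i : E := x + (i%:R / n.+1%:R) *: h.
have frac01 n i : (i <= n.+1)%N -> 0 <= (i%:R / n.+1%:R : R) <= 1.
  by move=> le_in; rewrite divr_ge0//= ler_pdivrMr// mul1r ler_nat.
have Kw n i : (i <= n.+1)%N -> K (w n i).
  by move=> /frac01; exact: convex_set_segment.
have grid n i : (i <= n.+1)%N -> f (w n i) <= f x +
    i%:R / n.+1%:R * dot (gradf x) h
    + Lf * `|h| ^+ 2 * (i%:R * (i%:R + 1) / 2) / n.+1%:R ^+ 2.
  elim: i => [_|i IHi lt_in].
    by rewrite /w !(mul0r, scale0r, mulr0, addr0).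
  have n0 : n.+1%:R != 0 :> R by rewrite pnatr_eq0.
  have Kw1 := Kw _ _ lt_in.
  have grad_le := convex_gradient_le Kw1 (Kw _ _ (ltnW lt_in)).
  have w_step : w n i - w n i.+1 = - n.+1%:R^-1 *: h.
    rewrite /w opprD addrACA subrr add0r -scalerBl; congr (_ *: _).
    by rewrite -(natr1 i); field.
  rewrite w_step dotZr in grad_le.
  have lip := f_lip Kw1 Kx.
  rewrite {2}/w [x + _ - x]addrAC subrr add0r normrZ ger0_norm in lip; last first.
    by case/andP: (frac01 _ _ lt_in).
  have dual_le := le_dual_norm dot (gradf (w n i.+1) - gradf x) h.
  rewrite dotBl lerBlDl in dual_le.
  have {}dual_le : dot (gradf (w n i.+1)) h <=
      dot (gradf x) h + Lf * (i.+1%:R / n.+1%:R * `|h|) * `|h|.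
    by apply: (le_trans dual_le); rewrite lerD2l ler_wpM2r.
  have Ninv_ge0 : 0 <= n.+1%:R^-1 :> R by rewrite invr_ge0.
  have -> : f x + i.+1%:R / n.+1%:R * dot (gradf x) h
      + Lf * `|h| ^+ 2 * (i.+1%:R * (i.+1%:R + 1) / 2) / n.+1%:R ^+ 2
    = (f x + i%:R / n.+1%:R * dot (gradf x) h
       + Lf * `|h| ^+ 2 * (i%:R * (i%:R + 1) / 2) / n.+1%:R ^+ 2)
      + n.+1%:R^-1 * (dot (gradf x) h
        + Lf * (i.+1%:R / n.+1%:R * `|h|) * `|h|).
    by rewrite -(natr1 i); field.
  apply: le_trans (lerD (IHi (ltnW lt_in)) (ler_wpM2l Ninv_ge0 dual_le)).
  by rewrite -lerBlDl -lerN2 opprB -mulNr.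
apply/ler_addgt0Pr => e e0.
set c := Lf / 2 * `|h| ^+ 2.
(* The error at the endpoint [i = n.+1] is [c / n.+1]. *)
have [n /ltW ce_le_n] : exists n, `|c| / e < n%:R.
  by exists (Num.bound (`|c| / e)); apply: archi_boundP; rewrite divr_ge0// ltW.
have := grid n n.+1 (leqnn _).
have n0 : n.+1%:R != 0 :> R by rewrite pnatr_eq0.
have n_gt0 : 0 < n.+1%:R :> R by rewrite ltr0n.
have -> : w n n.+1 = y by rewrite /w divff// scale1r addrC subrK.
have -> : Lf * `|h| ^+ 2 * (n.+1%:R * (n.+1%:R + 1) / 2) / n.+1%:R ^+ 2
    = c + c / n.+1%:R by rewrite /c; field.
have c_le_e : c / n.+1%:R <= e.
  rewrite ler_pdivrMr//; apply: le_trans (ler_norm c) _.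
  rewrite ler_pdivrMr// in ce_le_n; rewrite mulrC -natr1; nra.
by rewrite divff// mul1r => /le_trans; apply; rewrite addrA lerD2l.
Qed.

End SmoothConvex.

(** * The composite problem over the lifted cone *)

Lemma conv_hull_convex {R : realType} {V : lmodType R} (A : set V) :
  convex_set (conv_hull A).
Proof.
move=> x y s; rewrite !inE => hull_x hull_y B [B_conv AB] /=.
have := B_conv x y s; rewrite !inE; apply.
  by apply: hull_x; split.
by apply: hull_y; split.
Qed.

Lemma opt_val_le {R : realType} (T : Type) (F : T -> R) (A : set T) (m : R) x :
  (forall y, A y -> m <= F y) -> A x -> opt_val F A <= F x.
Proof.
move=> m_le Ax; apply: ge_inf; last by exists x.
by exists m => _ [y Ay <-]; exact: m_le.
Qed.

Section CompositeGradient.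
Context {R : realType} {E : finNormedModType R}.
Variables (dot : {dot E for idfun}) (K : set E) (kappa Lf : R).
Variables (f : E -> R) (gradf lo : E -> E) (Dplus : R).
Hypotheses (K_cone : convex_cone K) (kappa_gt0 : 0 < kappa).

Local Notation Kplus := (Kplus K).
Local Notation F := (Fobj kappa f).
Local Notation Dstar := (Dstar K kappa f).
Local Notation hull z := (conv_hull (Delta gradf lo Dplus z `|` [set z])).

Let K_conv : convex_set K. Proof. by case: K_cone. Qed.

Lemma cone0 : K 0.
Proof.
by case: K_cone => -[x Kx] _ /(_ 0 x (lexx 0) Kx); rewrite scale0r.
Qed.

Lemma Kplus0 : Kplus 0.
Proof. by split; [exact: cone0|rewrite normr0]. Qed.

Lemma Fobj0 : F 0 = f 0.
Proof. by rewrite /Fobj mulr0 add0r. Qed.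

Lemma Kplus_convex : convex_set Kplus.
Proof.
move=> [x r] [y q] s; rewrite !inE => -[/= Kx xr] [/= Ky yq].
have s0 : 0 <= s%:num by [].
have s1 : 0 <= 1 - s%:num by rewrite subr_ge0.
split => /=.
  by have := @K_conv x y s; rewrite !inE; apply.
apply: le_trans (ler_normD _ _) _; rewrite !normrZ !ger0_norm//.
by apply: lerD; apply: ler_wpM2l.
Qed.

Hypothesis D_exists : exists D : R, level_bound K kappa f D.

Lemma Dstar_level_bound : level_bound K kappa f Dstar.
Proof.
move=> z Kz Fz; apply: lb_le_inf; first by case: D_exists => D; exists D.
by move=> D; apply.
Qed.

Lemma Dstar_ge0 : 0 <= Dstar.
Proof. by apply: (Dstar_level_bound Kplus0); rewrite Fobj0. Qed.

Hypotheses (f_conv : convex_function K f) (f_grad : gradient_on dot K f gradf).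

(** On the level set of [0] the radius is at most [Dstar], so the affine
    minorant of [f] at [0] is bounded there; off the level set [F > f 0]. *)
Lemma Fobj_lower_bound : exists m, forall z, Kplus z -> m <= F z.
Proof.
have [M M0 leM] := dot_bounded dot (gradf 0).
exists (f 0 - M * Dstar) => z Kz.
have [Fz|/ltW] := leP (F z) (f 0); last first.
  by apply: le_trans; rewrite gerBl mulr_ge0// Dstar_ge0.
have zD := Dstar_level_bound Kz Fz; case: Kz => Kz1 z12.
have := convex_gradient_le K_conv f_conv f_grad cone0 Kz1.
rewrite subr0 lerBrDl => f_ge.
apply: le_trans (_ : f z.1 <= _); last first.
  have z2_ge0 : 0 <= z.2 := le_trans (normr_ge0 _) z12.
  by rewrite /Fobj lerDr; exact: mulr_ge0 (ltW kappa_gt0) z2_ge0.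
apply: le_trans f_ge; rewrite lerD2l lerNl.
apply: le_trans (_ : M * `|z.1| <= _); last first.
  exact: ler_wpM2l M0 _ _ (le_trans z12 zD).
by apply: le_trans (leM _); rewrite -normrN ler_norm.
Qed.

Hypothesis lo_spec : lo_oracle dot K lo.

Lemma ray_Kplus eta rho : 0 <= rho -> Kplus (rho *: (lo eta, 1)).
Proof.
have [K_lo lo1 _ _ _] := lo_spec eta; case: K_cone => _ _ K_scale rho0.
split=> /=; first exact: K_scale.
by rewrite normrZ ger0_norm// ler_wpM2l.
Qed.

Lemma hull_sub_Kplus z : Kplus z -> hull z `<=` Kplus.
Proof.
move=> Kz; apply: smallest_sub; first exact: Kplus_convex.
by move=> _ [[rho /= /andP[rho0 _] <-]|->//]; exact: ray_Kplus.
Qed.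

Lemma opt_hull_le z w : Kplus z -> hull z w -> opt_val F (hull z) <= F w.
Proof.
move=> Kz; have [m m_le] := Fobj_lower_bound.
by apply: (@opt_val_le _ _ F _ m) => y /(hull_sub_Kplus Kz); exact: m_le.
Qed.

(** * One step of the algorithm *)

(** The radius [u.2] is the multiple of the oracle's answer at which the
    linearization at [z] is at most its value at [u]. *)
Lemma linearized_gap z u : Kplus z -> Kplus u ->
  let v : E * R^o := u.2 *: (lo (gradf z.1), 1) in
  kappa * (v.2 - z.2) + dot (gradf z.1) (v.1 - z.1) <= F u - F z.
Proof.
move=> [Kz1 z12] [Ku1 u12] /=.
have [K_lo lo1 lo_min _ _] := lo_spec (gradf z.1).
have lo_le : dot (gradf z.1) (u.2 *: lo (gradf z.1)) <= dot (gradf z.1) u.1.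
  have [u0|u_neq0] := eqVneq u.2 0.
    move: u12; rewrite u0 normr_le0 => /eqP ->.
    by rewrite scale0r.
  have u_gt0 : 0 < u.2 by rewrite lt_neqAle eq_sym u_neq0 (le_trans _ u12).
  have := lo_min (u.2^-1 *: u.1); rewrite !dotZr ler_pdivlMl//; apply.
    by case: K_cone => _ _; apply => //; rewrite invr_ge0 ltW.
  by rewrite normrZ gtr0_norm ?invr_gt0// ler_pdivrMl// mulr1.
have f_ge := convex_gradient_le K_conv f_conv f_grad Kz1 Ku1.
have -> : F u - F z = kappa * (u.2 - z.2) + (f u.1 - f z.1).
  by rewrite /Fobj; ring.
have -> : u.2 *: (1 : R^o) = u.2 by rewrite -[LHS]/(u.2 * 1) mulr1.
rewrite lerD2l; apply: le_trans f_ge.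
by rewrite !dotBr lerD2r.
Qed.

Hypothesis f_lip : lipschitz_gradient_on dot K gradf Lf.

Lemma Fobj_segment_le z v (s : R) : Kplus z -> Kplus v -> 0 <= s <= 1 ->
  F (z + s *: (v - z)) <= F z
    + s * (kappa * (v.2 - z.2) + dot (gradf z.1) (v.1 - z.1))
    + Lf / 2 * s ^+ 2 * `|v.1 - z.1| ^+ 2.
Proof.
move=> [Kz1 z12] [Kv1 v12] s01.
have Kw := convex_set_segment K_conv Kz1 Kv1 s01.
have := smooth_descent K_conv f_conv f_grad f_lip Kz1 Kw.
rewrite [z.1 + _ - z.1]addrAC subrr add0r dotZr normrZ.
have s0 : 0 <= s by case/andP: s01.
rewrite (ger0_norm s0) /Fobj /= => f_le.
rewrite exprMn in f_le.
move: f_le; rewrite -[s *: (v.2 - _)]/(s * (v.2 - z.2)).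
move: (dot _ _) (f z.1) (f _) (z.2 : R) (v.2 : R) `|_| => d a b zz vv c.
lra.
Qed.

Hypothesis Lf_ge0 : 0 <= Lf.

(** The bounds [r] and [q] on the radii are kept apart because the first
    iterate has radius [0]: this is what makes the bound after one step good
    enough to start the recursion. *)
Lemma cndg_step z z' u (s r q : R) : Kplus z -> Kplus u -> u.2 <= Dplus ->
  z.2 <= r -> u.2 <= q -> F z' <= opt_val F (hull z) -> 0 <= s <= 1 ->
  F z' - F u <= (1 - s) * (F z - F u) + Lf / 2 * s ^+ 2 * (r + q) ^+ 2.
Proof.
move=> Kz Ku uD zr uq Fz' s01.
have u0 : 0 <= u.2 by case: Ku => _; exact: le_trans.
pose v : E * R^o := u.2 *: (lo (gradf z.1), 1).
have v2 : v.2 = u.2 by rewrite -[LHS]/(u.2 * 1) mulr1.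
have Kv : Kplus v by exact: ray_Kplus.
have hull_w : hull z (z + s *: (v - z)).
  apply: convex_set_segment s01; first exact: conv_hull_convex.
    by apply: sub_gen_smallest; right.
  by apply: sub_gen_smallest; left; exists u.2 => //=; rewrite u0.
have s0 : 0 <= s by case/andP: s01.
have len : `|v.1 - z.1| <= r + q.
  rewrite [leRHS]addrC; apply: le_trans (ler_normB _ _) _; apply: lerD.
    by apply: le_trans uq; rewrite -v2; case: Kv.
  by apply: le_trans zr; case: Kz.
have sq : Lf / 2 * s ^+ 2 * `|v.1 - z.1| ^+ 2 <= Lf / 2 * s ^+ 2 * (r + q) ^+ 2.
  rewrite ler_wpM2l ?mulr_ge0 ?exprn_ge0//.
  have l0 := normr_ge0 (v.1 - z.1).
  by apply: lerXn2r; rewrite ?nnegrE//; exact: le_trans l0 len.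
have gap := linearized_gap Kz Ku.
have Fw := Fobj_segment_le Kz Kv s01.
have := le_trans Fz' (le_trans (opt_hull_le Kz hull_w) Fw).
have := ler_wpM2l s0 gap; move: sq.
rewrite -/v v2.
move: `|_| (_ + dot _ _) (F z) (F u) (F z') => l d a b c.
lra.
Qed.

End CompositeGradient.

(** A negative Lipschitz constant forces [K] to be trivial, because the dual
    norm is nonnegative; then [F] is [kappa * r] up to a constant. *)
Lemma lipschitz_lt0_Dstar_eq0 {R : realType} {E : finNormedModType R}
    (dot : {dot E for idfun}) (K : set E) (kappa Lf : R) (f : E -> R)
    (gradf : E -> E) :
  convex_cone K -> 0 < kappa -> lipschitz_gradient_on dot K gradf Lf ->
  Lf < 0 -> Dstar K kappa f = 0.
Proof.
move=> K_cone kappa_gt0 f_lip Lf_lt0.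
have K_eq0 x : K x -> x = 0.
  move=> Kx; have := le_trans (dual_norm_ge0 _ _) (f_lip _ _ Kx (cone0 K_cone)).
  by rewrite nmulr_rge0// subr0 normr_le0 => /eqP.
have level0 : level_bound K kappa f 0.
  move=> u [/K_eq0 u0 _]; rewrite /Fobj u0 gerDr.
  by rewrite -[leRHS](mulr0 kappa) ler_pM2l.
apply/le_anti/andP; split; last by apply: Dstar_ge0 => //; exists 0.
apply: ge_inf => //; exists 0 => D levelD.
by apply: (levelD 0 (Kplus0 K_cone)); rewrite Fobj0.
Qed.

(** * The convergence rate *)

(** With [n = t + 14] and [s = 2 / n], the recursion turns [8 C / n] into
    [8 C (1 / n - 1 / n^2)], which is at most [8 C / (n + 1)]. *)
Lemma quadratic_recursion_rate {R : realType} (C : R) (e : nat -> R) :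
  0 <= C -> e 2%N <= C / 2 ->
  (forall t (s : R), (2 <= t)%N -> 0 <= s <= 1 ->
    e t.+1 <= (1 - s) * e t + 2 * C * s ^+ 2) ->
  forall t, (2 <= t)%N -> e t <= 8 * C / (t%:R + 14).
Proof.
move=> C0 e2 step t; elim: t => [//|t IHt].
rewrite leq_eqVlt => /orP[/eqP <-|].
  by have -> : 8 * C / (2%:R + 14) = C / 2 by field.
rewrite ltnS => t2; have {}IHt := IHt t2.
have n_ge2 : 2 <= t%:R + 14 :> R by have : 0 <= t%:R :> R by []; lra.
have -> : t.+1%:R + 14 = (t%:R + 14) + 1 :> R by rewrite -natr1 addrAC.
move: IHt (step t (2 / (t%:R + 14)) t2) n_ge2.
set n := t%:R + 14 => IHt e_step n_ge2.
have n_gt0 : 0 < n by apply: lt_le_trans n_ge2.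
have s01 : 0 <= 2 / n <= 1.
  by rewrite ler_pdivrMr// mul1r n_ge2 andbT divr_ge0// ltW.
apply: le_trans (e_step s01) _.
have s_ge0 : 0 <= 1 - 2 / n by rewrite subr_ge0; case/andP: s01.
apply: le_trans (lerD (ler_wpM2l s_ge0 IHt) (lexx _)) _.
rewrite -subr_ge0.
have -> : 8 * C / (n + 1) -
    ((1 - 2 / n) * (8 * C / n) + 2 * C * (2 / n) ^+ 2)
    = 8 * C / (n ^+ 2 * (n + 1)).
  by field; rewrite !gt_eqF// ltr_wpDr.
by rewrite divr_ge0 ?mulr_ge0 ?exprn_ge0 ?addr_ge0// ltW.
Qed.

Unset Implicit Arguments.

Theorem theorem3 (R : realType) (E : finNormedModType R)
    (dot : {dot E for idfun})
    (K : set E) (kappa Lf Dplus : R) (f : E -> R) (gradf : E -> E)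
    (lo : E -> E) (z : nat -> E * R^o)
    (K_closed : closed K) (K_cone : convex_cone K) (K_span : spanning K)
    (kappa_gt0 : 0 < kappa)
    (f_convex : convex_function K f)
    (f_grad : gradient_on dot K f gradf)
    (f_lip : lipschitz_gradient_on dot K gradf Lf)
    (lo_spec : lo_oracle dot K lo)
    (D_exists : exists D : R, level_bound K kappa f D)
    (Dplus_ge : Dstar K kappa f <= Dplus)
    (z_cndg : generic_cndg K kappa f gradf lo Dplus z) :
  [/\ forall t, (1 <= t)%N -> Kplus K (z t),
      forall t, (1 <= t)%N ->
        Fobj kappa f (z t.+1) <= Fobj kappa f (z t) &
      forall t, (2 <= t)%N ->
        Fobj kappa f (z t) - Fstar K kappa f
          <= 8 * Lf * Dstar K kappa f ^+ 2 / (t%:R + 14)].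
Proof.
have [z1 z_next] := z_cndg.
have Kz t : (1 <= t)%N -> Kplus K (z t).
  case: t => [//|[_|t _]]; first by rewrite z1; exact: Kplus0.
  by case: (z_next t.+1 isT).
have descent t : (1 <= t)%N -> Fobj kappa f (z t.+1) <= Fobj kappa f (z t).
  move=> t1; have [_ /le_trans] := z_next t t1; apply.
  apply: (opt_hull_le K_cone kappa_gt0 D_exists f_convex f_grad lo_spec (Kz t t1)).
  by apply: sub_gen_smallest; right.
have z_level t : (1 <= t)%N -> Fobj kappa f (z t) <= f 0.
  elim: t => [//|[_ _|t IHt _]]; first by rewrite z1 Fobj0.
  exact: le_trans (descent t.+1 isT) (IHt isT).
set D := Dstar K kappa f.
have D_ge0 : 0 <= D by exact: Dstar_ge0.
have D_level := Dstar_level_bound D_exists.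
(* A nonnegative Lipschitz constant that leaves the bound unchanged. *)
pose L := Num.max Lf 0.
have L_ge0 : 0 <= L by rewrite le_max lexx orbT.
have L_lip : lipschitz_gradient_on dot K gradf L.
  move=> x y Kx Ky; apply: le_trans (f_lip x y Kx Ky) _.
  by rewrite ler_wpM2r// le_max lexx.
have LD : Lf * D ^+ 2 = L * D ^+ 2.
  have [/max_idPl <- //|Lf_lt0] := leP 0 Lf.
  have D0 : D = 0 by exact: lipschitz_lt0_Dstar_eq0 f_lip Lf_lt0.
  by rewrite D0 expr0n /= !mulr0.
split=> // t t2; rewrite -(mulrA 8) LD lerBlDr -lerBlDl.
have C_ge0 : 0 <= L * D ^+ 2 by rewrite mulr_ge0// exprn_ge0.
apply: lb_le_inf.
  by exists (f 0); exists 0; [exact: Kplus0|rewrite Fobj0].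
move=> _ [u Ku <-]; rewrite lerBlDl -lerBlDr.
have [Fu|/ltW Fu] := leP (Fobj kappa f u) (f 0); last first.
  apply: le_trans (_ : 0 <= _).
    by rewrite subr_le0; apply: le_trans Fu; apply: z_level; exact: ltnW.
  by rewrite divr_ge0 ?mulr_ge0 ?addr_ge0.
have uD : u.2 <= D by exact: D_level.
have step t' (s r : R) : (1 <= t')%N -> (z t').2 <= r -> 0 <= s <= 1 ->
    Fobj kappa f (z t'.+1) - Fobj kappa f u
    <= (1 - s) * (Fobj kappa f (z t') - Fobj kappa f u)
       + L / 2 * s ^+ 2 * (r + D) ^+ 2.
  move=> t'1 zr s01; have [_ Fz] := z_next t' t'1.
  exact: (cndg_step K_cone kappa_gt0 D_exists f_convex f_grad lo_spec L_lip
    L_ge0 (Kz t' t'1) Ku (le_trans uD Dplus_ge)).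
pose gap t := Fobj kappa f (z t) - Fobj kappa f u.
apply: (@quadratic_recursion_rate _ _ gap) => //.
  have := step 1%N 1 0 isT; rewrite z1 => /(_ (lexx _)).
  rewrite ler01 lexx => /(_ isT)/le_trans; apply.
  by rewrite subrr mul0r add0r expr1n mulr1 add0r mulrAC.
move=> t' s t'2 s01; have t'1 := ltnW t'2.
apply: le_trans (step t' s D t'1 (D_level _ (Kz _ t'1) (z_level _ t'1)) s01) _.
by rewrite lerD2l le_eqVlt; apply/orP; left; apply/eqP; field.
Qed.
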